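(* Let $N,r$ be integers with $1<N<r$, let $p\in(0,1)$, and let the offspring distribution of a Bienaymé–Galton–Watson process have probability generating function $f(s)=(1-p)s+ps^r$. Let $V_N$ be the number of disjoint complete infinite $N$-ary subtrees rooted at the ancestor of the family tree. Let $\tau_N$ be the largest solution in $[0,1]$ of the equation $$s=p\sum_{k=N}^r\binom{r}{k}s^k(1-s)^{r-k},$$ and let $B_r(\tau_N)$ be a binomial $(r,\tau_N)$ random variable. Then $$P(V_N=0)=1-p+p\,P(B_r(\tau_N)\le N-1),$$ and for $j=1,2,\ldots$ $$P(V_N=j)=p\,P(jN\le B_r(\tau_N)\le jN+U)\quad\text{if } jN\le r,$$ where $U=U_j=\min\{N-1,\,r-jN\}$, and $P(V_N=j)=0$ if $jN>r$. Moreover $$E V_N=p\sum_{j=1}^{[r/N]}j\,P(jN\le B_r(\tau_N)\le jN+U_j),$$ where $[x]$ is the integer part of $x$.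
   Context: The process starts with one ancestor (the root); each individual independently has $1$ child with probability $1-p$ and $r$ children with probability $p$. The family tree has the individuals as nodes and the parent–child relations as arcs. A complete infinite $N$-ary tree is a rooted tree in which every node has exactly $N$ children. Subtrees considered are those rooted at the ancestor; two such subtrees are disjoint if they have no common node other than the root. $V_N$ is the (maximal) number of pairwise disjoint complete infinite $N$-ary subtrees of the family tree rooted at the ancestor. *)

(* Defs.v *)
From HB Require Import structures.
From mathcomp Require Import all_boot all_order all_algebra finmap.
From mathcomp Require Import all_classical all_reals all_analysis.

Set Implicit Arguments.
Unset Strict Implicit.
Unset Printing Implicit Defensive.

Import Order.TTheory GRing.Theory Num.Theory.
Import numFieldNormedType.Exports.

Local Open Scope classical_set_scope.
Local Open Scope ring_scope.

(* Individuals carry Ulam-Harris labels: [::] is the ancestor, rcons u i is the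
   (i+1)-st child of u. A realisation of the process is a function x giving the
   number of children of every (potential) individual. *)
Section Trees.
Local Open Scope nat_scope.

Definition family_tree (x : seq nat -> nat) : set (seq nat) :=
  [set u | forall v i, prefix (rcons v i) u -> i < x v].

Definition rooted_subtree (t S : set (seq nat)) : Prop :=
  [/\ S `<=` t, S [::] & forall u i, S (rcons u i) -> S u].

Definition complete_Nary (N : nat) (S : set (seq nat)) : Prop :=
  forall u, S u -> ([set i | S (rcons u i)] #= `I_N)%card.

Definition disjoint_subtrees (S S' : set (seq nat)) : Prop :=
  S `&` S' = [set [::]].

Definition has_disjoint_Nary (N : nat) (x : seq nat -> nat) (k : nat) : Prop :=
  exists F : 'I_k -> set (seq nat),
    (forall i, rooted_subtree (family_tree x) (F i) /\ complete_Nary N (F i)) /\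
    (forall i j, i != j -> disjoint_subtrees (F i) (F j)).

(* The maximum is restricted to k <= x [::] to be taken over a finite set; by
   num_disjoint_NaryP below this is no restriction when N > 0. *)
Definition num_disjoint_Nary (N : nat) (x : seq nat -> nat) : nat :=
  \max_(k < (x [::]).+1 | `[< has_disjoint_Nary N x k >]) k.

Lemma has_disjoint_Nary0 N x : has_disjoint_Nary N x 0.
Proof. by exists (fun=> set0); split=> -[]. Qed.

Lemma has_disjoint_Nary_le N x k :
  0 < N -> has_disjoint_Nary N x k -> k <= x [::].
Proof.
move=> N0 [F [FT Fdisj]].
have ch i : exists c : 'I_(x [::]), F i [:: val c].
  have [[sub F0 _] Fc] := FT i.
  have [c Fic] : [set c | F i (rcons [::] c)] !=set0.
    apply/set0P/eqP => E; have := Fc _ F0; rewrite E => /card_esym /=.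
    rewrite card_eq0 => /eqP/seteqP[/(_ 0 N0)].
    by [].
  have cx : c < x [::] by apply: (sub _ Fic [::] c); rewrite prefix_refl.
  by exists (Ordinal cx).
have [c Fc] := choice ch.
suff /leq_card : injective c by rewrite !card_ord.
move=> i j cij; apply/eqP; apply: contraT => /Fdisj dij.
have : (F i `&` F j) [:: val (c i)] by split; [|rewrite cij]; exact: Fc.
by rewrite dij.
Qed.

Lemma num_disjoint_NaryP N x : 0 < N ->
  has_disjoint_Nary N x (num_disjoint_Nary N x) /\
  (forall k, has_disjoint_Nary N x k -> k <= num_disjoint_Nary N x).
Proof.
move=> N0; split.
  rewrite /num_disjoint_Nary; elim/big_ind: _ => [|a b|k /asboolP//].
    exact: has_disjoint_Nary0.
  by rewrite /maxn; case: ifP.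
move=> k hk; have kx : k < (x [::]).+1.
  by rewrite ltnS; exact: has_disjoint_Nary_le hk.
apply: (@leq_bigmax_cond _ _ (fun i : 'I__ => i : nat) (Ordinal kx)).
exact/asboolP.
Qed.

End Trees.

Section Process.
Context {d : measure_display} {T : measurableType d} {R : realType}.
Variable P : probability T R.

Definition mutually_independent (I : choiceType) d' (T' : measurableType d')
    (X : I -> {RV P >-> T'}) : Prop :=
  forall (J : {fset I}) (A : I -> set T'), (forall i, measurable (A i)) ->
    P (\bigcap_(i in [set` J]) (X i @^-1` A i)) =
    (\prod_(i <- J) P (X i @^-1` A i))%E.

Definition pgf (X : {RV P >-> nat}) (s : R) : \bar R :=
  'E_P[fun w => s ^+ X w].

(* xi u is the number of children of u if u is ever born; the extra labels
   outside of the family tree are harmless. *)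
Definition BGW_process (f : R -> R) (xi : seq nat -> {RV P >-> nat}) : Prop :=
  mutually_independent xi /\
  forall u s, 0 <= s <= 1 -> pgf (xi u) s = (f s)%:E.

Definition V_ (N : nat) (xi : seq nat -> {RV P >-> nat}) (w : T) : nat :=
  num_disjoint_Nary N (fun u => xi u w).

Definition binomial_RV (n : nat) (q : R) (B : {RV P >-> nat}) : Prop :=
  forall A : set nat, distribution P B A = binomial_prob n q A.

End Process.

Definition largest_in01 (R : realType) (E : R -> Prop) (t : R) : Prop :=
  [/\ 0 <= t <= 1, E t & forall s, 0 <= s <= 1 -> E s -> s <= t].

Definition U_ (N r j : nat) : nat := minn (N - 1) (r - j * N).

(* Main.v *)
(* Call a tree N-ary if it contains a complete infinite N-ary subtree. By
   König's lemma this holds iff at least N children of the root carry N-ary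
   trees, and disjoint N-ary subtrees correspond to disjoint N-sets of such
   children; hence V_N is the number of such children divided by N, rounded
   down. The subtrees of the children are independent of each other and of the
   number of children of the root, so given r children that number is binomial
   (r, q), where q is the probability that the family tree is N-ary (with a
   single child it is at most 1 < N). In particular q solves the fixed point
   equation s = p P(B_r(s) >= N). Moreover q is the limit of the probabilities
   q_n of being N-ary up to depth n, where q_0 = 1 and
   q_{n+1} = p P(B_r(q_n) >= N); by monotonicity every q_n is at least tau_N,
   so q = tau_N. *)

Require Import Defs.
From HB Require Import structures.
From mathcomp Require Import all_boot all_order all_algebra finmap.
From mathcomp Require Import all_classical all_reals all_analysis.
From mathcomp Require Import measurable_realfun.
From mathcomp Require Import zify ring lra.

Set Implicit Arguments.
Unset Strict Implicit.
Unset Printing Implicit Defensive.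

Import Order.TTheory GRing.Theory Num.Theory.
Import numFieldNormedType.Exports.

Local Open Scope classical_set_scope.
Local Open Scope ring_scope.

(** * Deterministic trees: N-ary subtrees and the children of the root *)

Section NaryTrees.
Local Open Scope nat_scope.
Implicit Types (x : seq nat -> nat) (u v : seq nat) (c : seq nat).

(** Relabels the subtree of child [i] so that [i] becomes the ancestor. The type [X] is free so as
    to serve both realisations and families of random variables. *)
Definition shift (X : Type) (y : seq nat -> X) (i : nat) : seq nat -> X :=
  fun u => y (i :: u).

Fixpoint nary_upto N n x : bool :=
  if n is n'.+1
  then N <= count (fun i => nary_upto N n' (shift x i)) (iota 0 (x [::]))
  else true.

(** Phrased through finite depths so that the event is a countable intersection of measurable ones;
    [graftP] and [subtree_nary] relate it to actual subtrees. *)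
Definition nary N x : Prop := forall n, nary_upto N n x.

Definition nary_child N x : pred nat := fun i => `[< nary N (shift x i) >].

Lemma card_II_seqP (A : set nat) n :
  (A #= `I_n)%card <-> exists c, [/\ uniq c, size c = n & A = [set` c]].
Proof.
split=> [An|[c [uc sc ->]]].
  have Afin : finite_set A by apply/finite_setP; exists n.
  exists (enum_fset (fset_set A)); split; first exact: fset_uniq.
    exact: card_fset_set.
  by rewrite -[LHS](fset_setK Afin).
have -> : [set` c] = [set` [fset i in c]%fset].
  by apply/seteqP; split=> i /=; rewrite inE.
by apply/card_eq_fsetP; rewrite card_fseq undup_id.
Qed.

Lemma nary_uptoW N n x : nary_upto N n.+1 x -> nary_upto N n x.
Proof.
elim: n x => [//|n IHn] x /=; move/leq_trans; apply.
by apply: sub_count => i; exact: IHn.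
Qed.

Lemma nary_upto_le N m n x : m <= n -> nary_upto N n x -> nary_upto N m x.
Proof.
by move=> /subnK <-; elim: (n - m) => [//|k IHk] /nary_uptoW.
Qed.

(* König's lemma: among finitely many children, those that survive at every
   depth are those that survive at some single large depth. *)
Lemma count_nary_child N x : exists n,
  count (fun i => nary_upto N n (shift x i)) (iota 0 (x [::])) =
  count (nary_child N x) (iota 0 (x [::])).
Proof.
suff [n Hn] : exists n, {in iota 0 (x [::]), forall i,
    nary_upto N n (shift x i) = nary_child N x i}.
  by exists n; exact: eq_in_count.
elim: (iota 0 _) => [|i s [n Hn]]; first by exists 0.
have [m Hm] : exists m, forall k, m <= k ->
    nary_upto N k (shift x i) = nary_child N x i.
  rewrite /nary_child; case: asboolP => [H|H]; first by exists 0 => k _; exact: H.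
  have /existsNP[m Hm] := H; exists m => k mk.
  by apply/negP => /(nary_upto_le mk).
exists (maxn m n) => j; rewrite inE => /orP[/eqP ->|js].
  by rewrite Hm ?leq_maxl.
apply/idP/idP => [/(nary_upto_le (leq_maxr m n))|]; first by rewrite Hn.
by move=> /asboolP; apply.
Qed.

(** By [count_nary_child], survival of the root to one suitable depth [n.+1] already yields enough
    children that survive forever. *)
Lemma naryP N x : nary N x <-> N <= count (nary_child N x) (iota 0 (x [::])).
Proof.
split=> [Nx|le].
  by have [n <-] := count_nary_child N x; exact: (Nx n.+1).
case=> [//|n] /=; apply: (leq_trans le); apply: sub_count => i /asboolP.
exact.
Qed.

(** Keeping the smallest [N] labels makes the selection canonical, so that [nary_mem] can grow a
    subtree by recursion on the label. *)
Definition nary_choice N x : seq nat :=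
  take N [seq i <- iota 0 (x [::]) | nary_child N x i].

Fixpoint nary_mem N x u : Prop :=
  if u is i :: v then i \in nary_choice N x /\ nary_mem N (shift x i) v
  else True.

(** Only the children of the root are prescribed; below them the canonical subtrees are used.
    Disjoint lists [c] therefore give disjoint subtrees. *)
Definition graft N x c : set (seq nat) :=
  [set u | if u is i :: v then i \in c /\ nary_mem N (shift x i) v else True].

Lemma family_tree_cons x i u :
  family_tree x (i :: u) <-> i < x [::] /\ family_tree (shift x i) u.
Proof.
split=> [H|[ix H] [|j v] k] /=.
- split; first by apply: (H [::] i); rewrite /= eqxx prefix0s.
  by move=> v j vj; apply: (H (i :: v) j); rewrite /= eqxx.
- by rewrite prefix0s andbT => /eqP ->.
- by case/andP => /eqP -> /H.
Qed.

Lemma nary_choiceP N x i : i \in nary_choice N x ->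
  i < x [::] /\ nary N (shift x i).
Proof.
by move=> /mem_take; rewrite mem_filter mem_iota => /andP[/asboolP ? /andP[_ ?]].
Qed.

Lemma nary_mem_family_tree N x u : nary_mem N x u -> family_tree x u.
Proof.
elim: u x => [x _ v i|i u IHu x [/nary_choiceP[ix _] /IHu H]].
  by rewrite prefixs0 -size_eq0 size_rcons.
exact/family_tree_cons.
Qed.

Lemma nary_mem_rcons N x u i : nary_mem N x (rcons u i) -> nary_mem N x u.
Proof. by elim: u x => [//|j u IHu] x /= [? /IHu]. Qed.

Lemma nary_choice_card N x : nary N x -> ([set` nary_choice N x] #= `I_N)%card.
Proof.
move=> /naryP Nx; apply/card_II_seqP; exists (nary_choice N x); split=> //.
  by rewrite take_uniq// filter_uniq// iota_uniq.
by rewrite size_takel// size_filter.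
Qed.

Lemma nary_mem_complete N x : nary N x -> complete_Nary N (nary_mem N x).
Proof.
move=> Nx u; elim: u x Nx => [|i u IHu] x Nx /=.
  move=> _; rewrite [X in (X #= _)%card](_ : _ = [set` nary_choice N x]).
    exact: nary_choice_card.
  by apply/seteqP; split=> i /=; [case|split].
move=> [ic H]; have [_ Ni] := nary_choiceP ic.
rewrite [X in (X #= _)%card](_ : _ =
  [set j | nary_mem N (shift x i) (rcons u j)]); first exact: IHu.
by apply/seteqP; split=> j /=; [case|split].
Qed.

Lemma graftP N x c : uniq c -> size c = N ->
  {in c, forall i, i < x [::] /\ nary N (shift x i)} ->
  rooted_subtree (family_tree x) (graft N x c) /\ complete_Nary N (graft N x c).
Proof.
move=> uc sc Hc; split; first split=> //.
- move=> [_ v i|i v [/Hc[ix _] Hv]].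
    by rewrite prefixs0 -size_eq0 size_rcons.
  by apply/family_tree_cons; split=> //; exact: nary_mem_family_tree Hv.
- by case=> [//|i u j /= [ic /nary_mem_rcons]].
move=> [_|i u [ic Hu]] /=.
  apply/card_II_seqP; exists c; split=> //.
  by apply/seteqP; split=> i /=; [case|split].
have [_ Ni] := Hc i ic.
rewrite [X in (X #= _)%card](_ : _ =
  [set j | nary_mem N (shift x i) (rcons u j)]); first exact: nary_mem_complete.
by apply/seteqP; split=> j /=; [case|split].
Qed.

Lemma rooted_subtree_shift x S i : rooted_subtree (family_tree x) S ->
  S [:: i] -> rooted_subtree (family_tree (shift x i)) (fun u => S (i :: u)).
Proof.
move=> [Sx S0 Sr] Si; split=> // [u /Sx/family_tree_cons[]//|u j].
by rewrite -rcons_cons => /Sr.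
Qed.

Lemma complete_Nary_shift N S i : complete_Nary N S ->
  complete_Nary N (fun u => S (i :: u)).
Proof. by move=> cS u /cS. Qed.

(** Induction on the depth: the [N] children of the root in [S] carry the shifted subtrees, to which
    the induction hypothesis applies. *)
Lemma subtree_nary N x S : rooted_subtree (family_tree x) S ->
  complete_Nary N S -> nary N x.
Proof.
move=> + + n; elim: n x S => [//|n IHn] x S rS cS /=.
have [Sx S0 _] := rS.
have /card_II_seqP[c [uc sc cE]] := cS _ S0.
rewrite -size_filter -[X in X <= _]sc; apply: uniq_leq_size => // i ic.
have Si : S [:: i] by have : [set` c] i by []; rewrite -cE.
have /family_tree_cons[ix _] := Sx _ Si.
rewrite mem_filter mem_iota ix !andbT.
exact: IHn (rooted_subtree_shift rS Si) (complete_Nary_shift cS).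
Qed.

(** From left to right, the subtrees use [k] sets of [N] N-ary children, disjoint because a shared
    child would be a common node other than the root. Conversely, the list of N-ary children is cut
    into [k] consecutive blocks of length [N], and a subtree is grafted on each block. *)
Lemma has_disjoint_NaryE N x k : 0 < N ->
  has_disjoint_Nary N x k <-> k * N <= count (nary_child N x) (iota 0 (x [::])).
Proof.
move=> N0; rewrite -size_filter; set s := (X in _ <-> _ <= size X).
have us : uniq s by rewrite filter_uniq// iota_uniq.
split=> [[F [FT Fd]]|ks].
  have /choice[c Hc] j : exists c, [/\ uniq c, size c = N &
      forall i, i \in c <-> F j [:: i]].
    have [[_ F0 _] /(_ _ F0)/card_II_seqP[c [uc sc cE]]] := FT j.
    by exists c; split=> // i; rewrite -[_ <-> _]/([set` c] i <-> _) -cE.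
  (* All the children of the root used by the [k] subtrees, listed together; [t] is duplicate-free
     and contained in [s]. *)
  pose t := [seq nth 0 (c j) i | j <- enum 'I_k, i <- iota 0 N].
  have <- : size t = k * N by rewrite size_allpairs size_enum_ord size_iota.
  have cmem j i : i < N -> F j [:: nth 0 (c j) i].
    by have [_ sc cP] := Hc j; move=> iN; apply/cP; rewrite mem_nth ?sc.
  apply: uniq_leq_size => [|i /allpairsP[[j l] /= [_]]].
    apply: allpairs_uniq; rewrite ?enum_uniq ?iota_uniq//.
    move=> [j i] [j' i'] /allpairsP[[a b] /= [_ + [-> ->]]].
    rewrite mem_iota => /= bN /allpairsP[[a' b'] /= [_ + [-> ->]]].
    rewrite mem_iota => /= bN' E.
    have aa : a = a'.
      apply/eqP; apply: contraT => /Fd d.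
      have : (F a `&` F a') [:: nth 0 (c a) b].
        by split; [|rewrite E]; exact: cmem.
      by rewrite d.
    rewrite -aa in E *; congr pair.
    by have [uc sc _] := Hc a; apply/eqP; rewrite -(nth_uniq 0 _ _ uc) ?sc ?E.
  rewrite mem_iota => /= lN ->; have Fi := cmem j l lN.
  have [rF cF] := FT j; have [Fx _ _] := rF.
  have /family_tree_cons[ix _] := Fx _ Fi.
  rewrite mem_filter mem_iota ix !andbT; apply/asboolP.
  exact: subtree_nary (rooted_subtree_shift rF Fi) (complete_Nary_shift cF).
pose c (j : 'I_k) := [seq nth 0 s (j * N + i) | i <- iota 0 N].
have idx (j : 'I_k) i : i < N -> j * N + i < size s.
  by move=> iN; apply: leq_trans ks; have := ltn_ord j; nia.
exists (fun j => graft N x (c j)); split=> [j|j j' jj'].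
  apply: graftP; rewrite ?size_map ?size_iota//.
    rewrite map_inj_in_uniq ?iota_uniq// => a b; rewrite !mem_iota => /= aN bN.
    by move/eqP; rewrite nth_uniq ?idx// eqn_add2l => /eqP.
  move=> i /mapP[l]; rewrite mem_iota => /= lN ->.
  have := mem_nth 0 (idx j l lN).
  by rewrite mem_filter mem_iota => /andP[/asboolP ? /andP[_ ?]].
apply/seteqP; split=> [[//|i u] /= [[]]|_ ->//].
move=> /mapP[a]; rewrite mem_iota => /= aN -> _ [/mapP[b]].
rewrite mem_iota => /= bN /eqP; rewrite nth_uniq ?idx// => /eqP E.
case/negP: jj'; apply/eqP/val_inj => /=.
(* Dividing a position in [s] by [N] recovers the index of its block. *)
have := congr1 (divn^~ N) E.
by rewrite !divnMDl// !divn_small// !addn0.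
Qed.

Lemma num_disjoint_NaryE N x : 0 < N ->
  num_disjoint_Nary N x = count (nary_child N x) (iota 0 (x [::])) %/ N.
Proof.
move=> N0; have [h hmax] := num_disjoint_NaryP x N0.
apply/eqP; rewrite eqn_leq; apply/andP; split.
  by rewrite leq_divRL//; apply/has_disjoint_NaryE.
by apply/hmax/has_disjoint_NaryE => //; rewrite leq_trunc_div.
Qed.

End NaryTrees.

(** * Measurability of the N-ary events *)

Section CountableMeasurability.
Context {d : measure_display} {S : measurableType d}.

(** Splitting along the countably many values of [f] handles counts whose range of summation is
    itself random. *)
Lemma measurable_fun_comp_nat d' (U : measurableType d') (f : S -> nat)
    (g : nat -> S -> U) :
  measurable_fun setT f -> (forall a, measurable_fun setT (g a)) ->
  measurable_fun setT (fun w => g (f w) w).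
Proof.
move=> mf mg _ A mA; rewrite setTI.
have -> : (fun w => g (f w) w) @^-1` A =
    \bigcup_a (f @^-1` [set a] `&` g a @^-1` A).
  by apply/seteqP; split=> [w Aw|w [a _ [<-]]] //; exists (f w).
apply: bigcupT_measurable => a; apply: measurableI.
  by rewrite -[X in measurable X]setTI; exact: mf.
by rewrite -[X in measurable X]setTI; exact: mg.
Qed.

Lemma measurable_count (e : nat -> S -> bool) m :
  (forall i, (i < m)%N -> measurable_fun setT (e i)) ->
  measurable_fun setT (fun w => count (e^~ w) (iota 0 m)).
Proof.
elim: m => [|m IHm] me; first exact: measurable_cst.
rewrite (_ : (fun w => _) = (fun w => count (e^~ w) (iota 0 m) + e m w)%N).
  apply: (@measurable_fun_comp_nat _ _ (fun w => count (e^~ w) (iota 0 m))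
    (fun a w => (a + e m w)%N)) => [|a].
    by apply: IHm => i im; apply: me; exact: ltnW.
  apply: (@measurableT_comp _ _ _ _ _ _ (fun b : bool => (a + b)%N)) => //.
  exact: me.
by apply/funext => w; rewrite -addn1 iotaD count_cat /= addn0.
Qed.

Variable N : nat.

Lemma measurable_nary_upto n (X : seq nat -> S -> nat) :
  (forall u, measurable_fun setT (X u)) ->
  measurable_fun setT (fun w => nary_upto N n (X^~ w)).
Proof.
elim: n X => [|n IHn] X mX /=; first exact: measurable_cst.
apply: (@measurable_fun_comp_nat _ _ (X [::]) (fun m w =>
  (N <= count (fun i => nary_upto N n (shift (X^~ w) i)) (iota 0 m))%N)) => // m.
apply: (@measurableT_comp _ _ _ _ _ _ (fun k => (N <= k)%N)) => //.
by apply: measurable_count => i _; apply: (IHn (shift X i)) => u; exact: mX.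
Qed.

Lemma measurable_nary (X : seq nat -> S -> nat) :
  (forall u, measurable_fun setT (X u)) ->
  measurable_fun setT (fun w => `[< nary N (X^~ w) >]).
Proof.
move=> mX; apply: (measurable_fun_bool true); rewrite setTI.
rewrite [X in measurable X](_ : _ =
  \bigcap_n ((fun w => nary_upto N n (X^~ w)) @^-1` [set true])).
  apply: bigcapT_measurable => n; rewrite -[X in measurable X]setTI.
  exact: measurable_nary_upto.
apply/seteqP; split=> w /= H; first by move=> n _; exact: (asboolW H).
by apply/asboolP => n; exact: H.
Qed.

End CountableMeasurability.

(** * Independence of sigma-algebras generated by disjoint families of variables *)

Section Independence.
Context {d : measure_display} {T : measurableType d} {R : realType}.
Variable P : probability T R.

Local Open Scope ereal_scope.

(** Dynkin's pi-lambda theorem: the events independent of [F] form a Dynkin system that contains the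
    pi-system [C]. *)
Lemma g_sigma_algebra_indep (C : set (set T)) (F : set T) :
  setI_closed C -> C `<=` measurable -> measurable F ->
  (forall E, C E -> P (E `&` F) = P E * P F) ->
  forall E, <<s C >> E -> P (E `&` F) = P E * P F.
Proof.
move=> CI Cm mF CF E CE.
(* Measurability is carried along because the measures of complements and countable unions are
   computed from it. *)
suff [] : measurable E /\ P (E `&` F) = P E * P F by [].
move: E CE; rewrite -(setI_closed_g_dynkin_g_sigma_algebra CI).
apply: smallest_sub => [|E CE]; last by split; [exact: Cm|exact: CF].
split=> [|E [mE EF]|A tA mA] /=.
- by split=> //; rewrite setTI probability_setT mul1e.
- split; first exact: measurableC.
  rewrite probability_setC// muleBl ?fin_num_adde_defr// ?fin_num_measure// mul1e.
  by rewrite -EF setIC -setDE measureD ?ltey_eq ?fin_num_measure// setIC.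
- split; first by apply: bigcupT_measurable => n; have [] := mA n.
  rewrite setI_bigcupl muleC !measure_bigcup//=.
  + rewrite -(fineK (fin_num_measure P _ mF)) -nneseriesZl//.
    apply: eq_eseriesr => n _; rewrite fineK ?fin_num_measure//.
    by have [_] := mA n; rewrite muleC.
  + by move=> n _; have [] := mA n.
  + by move=> n _; apply: measurableI => //; have [] := mA n.
  + exact: trivIset_setIr.
Qed.

Context {I : choiceType} {d' : measure_display} {T' : measurableType d'}.
Variable X : I -> {RV P >-> T'}.

(** A pi-system generating the sigma-algebra of the variables [X i] with [i] in [L]. *)
Definition cylinders (L : set I) : set (set T) :=
  [set E | exists (J : {fset I}) (A : I -> set T'),
    [/\ [set` J] `<=` L, forall i, measurable (A i) &
        E = \bigcap_(i in [set` J]) (X i @^-1` A i)]].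

Lemma cylinders_measurable L : cylinders L `<=` measurable.
Proof.
move=> _ [J [A [_ mA ->]]]; apply: fin_bigcap_measurable => [|i _].
  exact: finite_fset.
by rewrite -[X in measurable X]setTI; exact: measurable_funP.
Qed.

Lemma cylinders_preimage L i A : L i -> measurable A ->
  cylinders L (X i @^-1` A).
Proof.
move=> Li mA; exists [fset i]%fset, (fun=> A); split=> //.
  by move=> j /=; rewrite inE => /eqP ->.
by rewrite set_fset1 bigcap_set1.
Qed.

Lemma cylinders_setI L L' J J' : cylinders L J -> cylinders L' J' ->
  cylinders (L `|` L') (J `&` J').
Proof.
move=> [K [A [KL mA ->]]] [K' [A' [KL' mA' ->]]].
(* Each family of constraints is made trivial outside its own index set, so one family describes the
   intersection. *)
exists (K `|` K')%fset, (fun i => (if i \in K then A i else setT) `&`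
  (if i \in K' then A' i else setT)); split.
- by move=> i /=; rewrite inE => /orP[/KL|/KL']; [left|right].
- by move=> i; apply: measurableI; case: ifP.
- apply/seteqP; split=> w.
    by move=> [HK HK'] i _; split; case: ifP => // ?; [exact: HK|exact: HK'].
  move=> H; split=> i /= iK.
    by have [] := H i; rewrite /= ?inE ?iK.
  by have [] := H i; rewrite /= ?inE ?iK ?orbT.
Qed.

Lemma cylinders_setI_closed L : setI_closed (cylinders L).
Proof.
by move=> E F; rewrite -[in X in _ -> _ -> X](setUid L); exact: cylinders_setI.
Qed.

Hypothesis Xindep : mutually_independent X.

(** The index sets are disjoint, so the two families of constraints merge into a single family [D]
    without conflict, and the product over the union factors. *)
Lemma cylinders_indep L L' E F : L `&` L' = set0 ->
  cylinders L E -> cylinders L' F -> P (E `&` F) = P E * P F.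
Proof.
move=> LL' [J [A [JL mA ->]]] [K [B [KL mB ->]]].
have JK i : i \in J -> i \in K = false.
  move=> iJ; apply/negP => iK.
  by have : (L `&` L') i by [split; [exact: JL|exact: KL]]; rewrite LL'.
pose D i := if i \in J then A i else B i.
rewrite [X in P X = _](_ : _ =
    \bigcap_(i in [set` (J `|` K)%fset]) (X i @^-1` D i)); last first.
  apply/seteqP; rewrite /D; split=> w.
    by move=> [HJ HK] i /=; rewrite inE; case: ifPn => iJ; [move=> _|];
      [exact: HJ|exact: HK].
  move=> H; split=> i /= iJ.
    by have := H i; rewrite /= inE iJ; apply.
  have := H i; rewrite /= inE iJ orbT; case: ifPn => [/JK|_]; last exact.
  by rewrite iJ.
rewrite !Xindep//; last by move=> i; rewrite /D; case: ifP.
rewrite (perm_big (J ++ K)) /=; last first.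
  apply: uniq_perm; rewrite ?fset_uniq// ?cat_uniq ?fset_uniq//=.
    by rewrite andbT; apply/hasPn => i iK; apply/negP => /JK; rewrite iK.
  by move=> i; rewrite mem_cat inE.
rewrite big_cat/=; congr (_ * _); apply: eq_big_seq => i iJ; rewrite /D.
  by rewrite iJ.
by case: ifPn => // /JK; rewrite iJ.
Qed.

Lemma g_cylinders_measurable L : <<s cylinders L >> `<=` measurable.
Proof.
apply: smallest_sub; first exact: sigma_algebra_measurable.
exact: cylinders_measurable.
Qed.

(** The pi-lambda argument is applied twice, extending one factor at a time from cylinders to the
    generated sigma-algebra. *)
Lemma g_cylinders_indep L L' E F : L `&` L' = set0 ->
  <<s cylinders L >> E -> <<s cylinders L' >> F ->
  P (E `&` F) = P E * P F.
Proof.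
move=> LL' EL FL'.
apply: (g_sigma_algebra_indep (@cylinders_setI_closed L)) EL.
- exact: cylinders_measurable.
- exact: g_cylinders_measurable FL'.
move=> C CL; rewrite setIC muleC.
apply: (g_sigma_algebra_indep (@cylinders_setI_closed L')) FL'.
- exact: cylinders_measurable.
- exact: cylinders_measurable CL.
by move=> D DL'; rewrite setIC muleC; exact: cylinders_indep CL DL'.
Qed.

End Independence.

(** * Expectations under the binomial law *)

Section BinomialExpectation.
Context {R : realType}.
Implicit Types (q s t : R) (a : nat -> R).

Definition bin_coef m k q : R := 'C(m, k)%:R * q ^+ k * (1 - q) ^+ (m - k).

(** The expectation of [a] at a binomial [(m, q)] variable; with [a] an indicator it is a binomial
    probability. *)
Definition bin_expect m q a : R := \sum_(k < m.+1) bin_coef m k q * a k.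

Lemma bin_coefS m k q :
  bin_coef m.+1 k.+1 q = (1 - q) * bin_coef m k.+1 q + q * bin_coef m k q.
Proof.
rewrite /bin_coef binS natrD subSS exprS.
have [km|mk] := ltnP k m; last by rewrite bin_small //; ring.
by rewrite (_ : (m - k = (m - k.+1).+1)%N) ?exprS; [ring|lia].
Qed.

(** Conditioning on one trial, by Pascal's rule. This recursion drives the later inductions on
    [m]. *)
Lemma bin_expectS m q a : bin_expect m.+1 q a =
  (1 - q) * bin_expect m q a + q * bin_expect m q (a \o succn).
Proof.
rewrite /bin_expect big_ord_recl /=.
under eq_bigr => k _ do
  rewrite bin_coefS mulrDl -[X in X + _]mulrA -[X in _ + X]mulrA.
rewrite big_split/= -!mulr_sumr addrA; congr (_ + _).
(* The top term carries the coefficient ['C(m, m.+1)], which is zero. *)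
rewrite [X in _ + _ * X]big_ord_recr/= {3}/bin_coef bin_small// !mul0r addr0.
rewrite [in RHS]big_ord_recl/= mulrDr; congr (_ + _).
by rewrite mulrA /bin_coef !bin0 !subn0 exprS; ring.
Qed.

Lemma bin_expect0 q a : bin_expect 0 q a = a 0%N.
Proof. by rewrite /bin_expect big_ord1 /bin_coef bin0 !expr0 !mul1r. Qed.

Lemma eq_bin_expect m q a b : (forall k, (k <= m)%N -> a k = b k) ->
  bin_expect m q a = bin_expect m q b.
Proof. by move=> ab; apply: eq_bigr => k _; rewrite ab// -ltnS. Qed.

Lemma bin_expect_cst m q (c : R) : bin_expect m q (fun=> c) = c.
Proof.
by elim: m => [|m IHm]; rewrite ?bin_expect0// bin_expectS IHm; ring.
Qed.

Lemma bin_coef_ge0 m k q : 0 <= q <= 1 -> 0 <= bin_coef m k q.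
Proof.
by case/andP=> q0 q1; rewrite !mulr_ge0 ?exprn_ge0 ?subr_ge0.
Qed.

Lemma le_bin_expect m q a b : 0 <= q <= 1 -> (forall k, a k <= b k) ->
  bin_expect m q a <= bin_expect m q b.
Proof.
by move=> q01 ab; apply: ler_sum => k _; rewrite ler_wpM2l ?bin_coef_ge0.
Qed.

(** The binomial law increases stochastically with its parameter: both conditional expectations
    grow, and the weight [t - s] moves from failure to success, where the expectation is larger. *)
Lemma bin_expect_homo m s t a : 0 <= s -> s <= t -> t <= 1 ->
  {homo a : k l / (k <= l)%N >-> k <= l} ->
  bin_expect m s a <= bin_expect m t a.
Proof.
move=> s0 st t1; elim: m a => [|m IHm] a ha; first by rewrite !bin_expect0.
have haS : {homo a \o succn : k l / (k <= l)%N >-> k <= l}.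
  by move=> k l kl; exact: ha.
have t01 : 0 <= t <= 1 by rewrite t1 (le_trans s0).
rewrite !bin_expectS; move: (IHm _ haS) (IHm _ ha).
have : bin_expect m t a <= bin_expect m t (a \o succn).
  by apply: le_bin_expect => // k; exact: ha.
set u := bin_expect m s (a \o succn); set v := bin_expect m t (a \o succn).
set w := bin_expect m s a; set z := bin_expect m t a => h1 h2 h3.
have h4 : s * u <= s * v by rewrite ler_wpM2l.
have h5 : (1 - s) * w <= (1 - s) * z by rewrite ler_wpM2l// subr_ge0 (le_trans st).
have h6 : (t - s) * z <= (t - s) * v by rewrite ler_wpM2l// subr_ge0.
nra.
Qed.

Lemma binomial_probE_expect m q (A : set nat) : 0 <= q <= 1 ->
  binomial_prob m q A = (bin_expect m q \1_A)%:E.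
Proof.
case/andP=> q0 q1; rewrite (binomial_probE _ (p0 := q0))// /bin_expect -sumEFin.
apply: eq_bigr => k _; rewrite EFinM; congr (_%:E * _)%E.
by rewrite /= -[LHS]mulr_natl mulrA.
Qed.

End BinomialExpectation.

(** * Expectations and generating functions of variables with values in [nat] *)

Section NatRV.
Context {d : measure_display} {T : measurableType d} {R : realType}.
Variable P : probability T R.

Lemma measurable_nat_preimage (Y : T -> nat) (A : set nat) :
  measurable_fun setT Y -> measurable (Y @^-1` A).
Proof. by move=> mY; rewrite -[X in measurable X]setTI; exact: mY. Qed.

Lemma integral_nat_sum (Y : T -> nat) (a : nat -> R) n :
  measurable_fun setT Y -> (forall k, 0 <= a k) ->
  (\int[P]_w (\sum_(k < n) a k * \1_(Y @^-1` [set nat_of_ord k]) w)%:E =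
   \sum_(k < n) (a k)%:E * P (Y @^-1` [set nat_of_ord k]))%E.
Proof.
move=> mY a0; under eq_integral => w _ do rewrite -sumEFin.
have mk k : measurable (Y @^-1` [set k]) by exact: measurable_nat_preimage.
rewrite ge0_integral_sum//=.
- apply: eq_bigr => k _; under eq_integral => w _ do rewrite EFinM.
  rewrite ge0_integralZl//= ?lee_fin//.
  + by rewrite integral_indic// setIT.
  + exact/measurable_EFinP.
- move=> k; apply/measurable_EFinP; apply: measurable_funM => //.
- by move=> k w _; rewrite lee_fin mulr_ge0.
Qed.

Lemma sum_nat_indic (Y : T -> nat) (a : nat -> R) n w :
  \sum_(k < n) a k * \1_(Y @^-1` [set nat_of_ord k]) w =
  if (Y w < n)%N then a (Y w) else 0.
Proof.
case: ifPn => [Yn|Yn].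
  rewrite (bigD1 (Ordinal Yn))//= big1 => [|k kY].
    by rewrite indicE mem_set// mulr1 addr0.
  rewrite indicE memNset ?mulr0// => /= Yk; case/eqP: kY.
  exact/val_inj.
rewrite big1// => k _; rewrite indicE memNset ?mulr0// => /= Yk.
by move: Yn; rewrite Yk ltn_ord.
Qed.

Lemma expectation_nat (Y : T -> nat) M : measurable_fun setT Y ->
  P [set w | (M < Y w)%N] = 0%E ->
  ('E_P[fun w => (Y w)%:R] =
   \sum_(1 <= j < M.+1) j%:R%:E * P [set w | Y w = j])%E.
Proof.
move=> mY YM; rewrite expectation.unlock.
(* Almost surely [Y] is at most [M], so it agrees with its truncation, a finite sum of
   indicators. *)
transitivity (\int[P]_w (\sum_(k < M.+1) k%:R *
    \1_(Y @^-1` [set nat_of_ord k]) w)%:E)%E.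
  apply: ae_eq_integral => //.
  - apply/measurable_EFinP.
    exact: (@measurableT_comp _ _ _ _ _ _ (fun k : nat => k%:R : R)).
  - apply/measurable_EFinP; apply: measurable_sum => k.
    by apply: measurable_funM => //; apply: measurable_indic;
      exact: measurable_nat_preimage.
  exists [set w | (M < Y w)%N]; split=> //.
    by apply: (@measurable_nat_preimage Y [set k | (M < k)%N]).
  move=> w /= H; rewrite ltnNge; apply/negP => YwM; apply: H => _.
  by rewrite (sum_nat_indic Y (fun k => k%:R)) ltnS YwM.
rewrite (integral_nat_sum (a := fun k => k%:R))//.
rewrite -(big_mkord xpredT (fun k => k%:R%:E * P (Y @^-1` [set k])))%E.
by rewrite big_nat_recl//= mul0e add0e big_add1.
Qed.

(** Where [X] is at least [n], the integrand [s ^+ X w] lies between 0 and [s ^+ n], and [P] has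
    total mass 1. *)
Lemma pgf_bounds (X : {RV P >-> nat}) (s : R) n : 0 <= s <= 1 ->
  (\sum_(k < n) (s ^+ k)%:E * P (X @^-1` [set nat_of_ord k]) <= pgf X s /\
   pgf X s <=
    \sum_(k < n) (s ^+ k)%:E * P (X @^-1` [set nat_of_ord k]) + (s ^+ n)%:E)%E.
Proof.
case/andP=> s0 s1; rewrite /pgf expectation.unlock.
have /= <- := @integral_nat_sum X (fun k => s ^+ k) n (measurable_funPT X)
  (fun k => exprn_ge0 k s0).
have mX : measurable_fun setT (fun w => (s ^+ X w)%:E).
  apply/measurable_EFinP.
  exact: (@measurableT_comp _ _ _ _ _ _ (fun k : nat => s ^+ k)).
have mS : measurable_fun setT (fun w =>
    (\sum_(k < n) s ^+ k * \1_(X @^-1` [set nat_of_ord k]) w)%:E).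
  apply/measurable_EFinP; apply: measurable_sum => k.
  by apply: measurable_funM => //; apply: measurable_indic;
      exact: measurable_nat_preimage.
have S0 w : (0 <= (\sum_(k < n) s ^+ k *
    \1_(X @^-1` [set nat_of_ord k]) w)%:E)%E.
  by rewrite lee_fin sumr_ge0// => k _; rewrite mulr_ge0 ?exprn_ge0.
split.
  apply: ge0_le_integral => // w _; rewrite lee_fin ?exprn_ge0//.
  by rewrite (sum_nat_indic X (fun k => s ^+ k)); case: ifP; rewrite ?exprn_ge0.
rewrite -[X in (_ <= _ + X)%E]mule1 -(probability_setT P).
rewrite -(integral_cst P measurableT) -ge0_integralD//; last first.
  by move=> w _; rewrite lee_fin exprn_ge0.
apply: ge0_le_integral => //.
- by move=> w _; rewrite lee_fin exprn_ge0.
- exact: emeasurable_funD.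
move=> w _; rewrite -EFinD lee_fin (sum_nat_indic X (fun k => s ^+ k)).
case: ltnP => h; first by rewrite lerDl exprn_ge0.
by rewrite add0r ler_wiXn2l.
Qed.

(** Strong induction on [k]: the terms below [k] cancel, and after division by [s ^+ k] the two
    coefficients differ by a multiple of [s], which tends to 0. *)
Lemma pgf_poly_coef (X : {RV P >-> nat}) (q : {poly R}) :
  (forall s, 0 <= s <= 1 -> pgf X s = (q.[s])%:E) ->
  forall k, P (X @^-1` [set k]) = (q`_k)%:E.
Proof.
move=> Xq k; have [n] := ubnP k; elim: n k => // n IHn k /ltnSE kn.
have {}IHn j : (j < k)%N -> P (X @^-1` [set j]) = (q`_j)%:E.
  by move=> jk; apply: IHn; apply: leq_trans kn.
have mk : measurable (X @^-1` [set k]) by exact: measurable_nat_preimage.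
have <- := fineK (fin_num_measure P _ mk); congr EFin.
(* [b] is the quotient of [q] by ['X^k.+1]; the sum [C] of its absolute coefficients bounds it on
   [0, 1]. *)
set x := fine _; pose b := drop_poly k.+1 q.
pose C := \sum_(i < size b) `|b`_i|.
have bC s : 0 <= s <= 1 -> `|b.[s]| <= C.
  case/andP=> s0 s1; rewrite horner_coef (le_trans (ler_norm_sum _ _ _))//.
  apply: ler_sum => i _; rewrite normrM ler_piMr// normrX ger0_norm//.
  exact: exprn_ile1.
have qE s : q.[s] = \sum_(i < k) s ^+ i * q`_i + s ^+ k * q`_k +
    s ^+ k.+1 * b.[s].
  rewrite -{1}(poly_take_drop k.+1 q) hornerD hornerM hornerXn mulrC; congr (_ + _).
  rewrite /take_poly horner_poly big_ord_recr/=; congr (_ + _); last by rewrite mulrC.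
  by apply: eq_bigr => i _; rewrite mulrC.
(* [C] accounts for the higher terms of [q], and 1 for the truncation error [s ^+ k.+1] of the
   generating function. *)
have bnd s : 0 < s -> s <= 1 -> `|x - q`_k| <= s * (C + 1).
  move=> s0 s1; have s01 : 0 <= s <= 1 by rewrite ltW.
  have [] := @pgf_bounds X s k.+1 s01; rewrite Xq//.
  rewrite big_ord_recr/= -(fineK (fin_num_measure P _ mk)) -/x.
  under eq_bigr => i _ do rewrite IHn//.
  rewrite -!EFinM; under eq_bigr do rewrite -EFinM.
  rewrite !sumEFin -!EFinD !lee_fin qE; set S := \sum_(_ < _) _ => h1 h2.
  have sk0 : 0 < s ^+ k by rewrite exprn_gt0.
  have /ler_normlP[b1 b2] := bC s s01.
  have sb1 : s * b.[s] <= s * C by rewrite ler_wpM2l// ltW.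
  have sb2 : - (s * b.[s]) <= s * C by rewrite -mulrN ler_wpM2l// ltW.
  have {}h1 : x <= q`_k + s * b.[s].
    rewrite -(ler_pM2l sk0) mulrDr mulrA -exprSr.
    by move: h1; rewrite -addrA lerD2l.
  have {}h2 : q`_k + s * b.[s] <= x + s.
    rewrite -(ler_pM2l sk0) !mulrDr mulrA -!exprSr.
    by move: h2; rewrite -!addrA lerD2l.
  by apply/ler_normlP; split; lra.
apply/eqP; rewrite -subr_eq0 -normr_le0; apply/ler_addgt0Pr => e e0.
have C0 : 0 < C + 1 by rewrite ltr_wpDl// sumr_ge0.
rewrite add0r; pose s := Num.min 1 (e / (C + 1)).
have s0 : 0 < s by rewrite lt_min ltr01 divr_gt0.
apply: (le_trans (bnd s s0 _)); first by rewrite ge_min lexx.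
by rewrite -ler_pdivlMr// ge_min lexx orbT.
Qed.

End NatRV.

(** * The branching process: law of the number of N-ary children and of [V_] *)

Section BGW.
Context {d : measure_display} {T : measurableType d} {R : realType}.
Variable P : probability T R.
Implicit Type xi : seq nat -> {RV P >-> nat}.

(* [measureU] coerces [P] to a function as a content, which later rewrite rules
   about [P] do not recognise. *)
Lemma disjoint_probU E F : measurable E -> measurable F -> E `&` F = set0 ->
  P (E `|` F) = (P E + P F)%E.
Proof. exact: measureU. Qed.

(** Quantifying over all measurable spaces allows the use of [T] with the smaller sigma-algebras
    generated by cylinders. *)
Definition measurable_functional (phi : (seq nat -> nat) -> bool) : Prop :=
  forall d' (S : measurableType d') (X : seq nat -> S -> nat),
    (forall u, measurable_fun setT (X u)) ->
    measurable_fun setT (fun w => phi (X^~ w)).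

(** The number [m] is fixed here, so that the count depends only on labels below the root and is
    independent of the offspring of the root. *)
Definition count_children (phi : (seq nat -> nat) -> bool) m xi w : nat :=
  count (fun i => phi (shift (fun u => xi u w) i)) (iota 0 m).

Definition from_root (I : set nat) : set (seq nat) :=
  [set u | exists i v, I i /\ u = i :: v].

Lemma measurable_RV_cylinders xi L u : L u ->
  measurable_fun setT (xi u : g_sigma_algebraType (cylinders xi L) -> nat).
Proof.
by move=> Lu _ A mA; rewrite setTI; apply: sub_sigma_algebra;
  exact: cylinders_preimage.
Qed.

Lemma measurable_child xi phi (I : set nat) i : measurable_functional phi ->
  I i ->
  measurable_fun setT ((fun w => phi (shift (fun u => xi u w) i)) :
    g_sigma_algebraType (cylinders xi (from_root I)) -> bool).
Proof.
move=> mphi Ii; apply: (mphi _ (g_sigma_algebraType (cylinders xi (from_root I)))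
  (fun u => xi (i :: u))) => u.
by apply: measurable_RV_cylinders; exists i, u.
Qed.

Lemma measurable_count_children xi phi m : measurable_functional phi ->
  measurable_fun setT (count_children phi m xi :
    g_sigma_algebraType (cylinders xi (from_root `I_m)) -> nat).
Proof.
move=> mphi; apply: (measurable_count
  (S := g_sigma_algebraType (cylinders xi (from_root `I_m)))
  (e := fun i w => phi (shift (fun u => xi u w) i))) => i im.
exact: measurable_child.
Qed.

Lemma g_count_children xi phi m A : measurable_functional phi ->
  <<s cylinders xi (from_root `I_m) >> (count_children phi m xi @^-1` A).
Proof.
move=> mphi; rewrite -[count_children _ _ _ @^-1` _]setTI.
exact: (@measurable_count_children xi phi m mphi measurableT A I).
Qed.

Lemma g_child xi phi i : measurable_functional phi ->
  <<s cylinders xi (from_root [set i]) >>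
    [set w | phi (shift (fun u => xi u w) i)].
Proof.
move=> mphi.
have /(_ measurableT [set true] I) := @measurable_child xi phi [set i] i mphi erefl.
by rewrite setTI.
Qed.

Lemma from_root_disj I J : I `&` J = set0 -> from_root I `&` from_root J = set0.
Proof.
move=> IJ; apply/seteqP; split=> // _ [[i [v [Ii ->]]] [j [u [Jj [ij _]]]]].
by rewrite -ij in Jj; have : (I `&` J) i by []; rewrite IJ.
Qed.

(** Induction on [m]: the tree of child [m] is independent of the earlier ones, and splitting on
    whether it satisfies [phi] reproduces [bin_expectS]. *)
Lemma prob_count_children xi phi q m A : measurable_functional phi ->
  mutually_independent xi ->
  (forall i, P [set w | phi (shift (fun u => xi u w) i)] = q%:E) ->
  P (count_children phi m xi @^-1` A) = (bin_expect m q \1_A)%:E.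
Proof.
move=> mphi xi_ind Pphi; elim: m A => [|m IHm] A.
  rewrite bin_expect0 indicE /count_children /=.
  have [A0|A0] := pselect (A 0%N).
    by rewrite mem_set// preimage_cst mem_set// probability_setT.
  by rewrite memNset// preimage_cst memNset// measure0.
pose e := [set w | phi (shift (fun u => xi u w) m)].
have ge := @g_child xi phi m mphi.
have me : measurable e by exact: g_cylinders_measurable ge.
have disj : from_root `I_m `&` from_root [set m] = set0.
  apply: from_root_disj; apply/seteqP; split=> // i [/= + im].
  by rewrite im ltnn.
have mc B : measurable (count_children phi m xi @^-1` B).
  exact: g_cylinders_measurable (@g_count_children xi phi m B mphi).
have split_e : count_children phi m.+1 xi @^-1` A =
    (count_children phi m xi @^-1` A `&` ~` e) `|`
    (count_children phi m xi @^-1` (succn @^-1` A) `&` e).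
  have cS w : count_children phi m.+1 xi w = (count_children phi m xi w +
      phi (shift (fun u => xi u w) m))%N.
    by rewrite /count_children -addn1 iotaD count_cat /= addn0.
  apply/seteqP; rewrite /e; split=> w /=; rewrite cS; case: (phi _) => /=.
  - by rewrite addn1; right.
  - by rewrite addn0; left.
  - by rewrite addn1 => -[[_ []]|[]].
  - by rewrite addn0 => -[[]|[]].
have indep B F : <<s cylinders xi (from_root [set m]) >> F ->
    P (count_children phi m xi @^-1` B `&` F) =
    (P (count_children phi m xi @^-1` B) * P F)%E.
  exact: (g_cylinders_indep xi_ind disj (@g_count_children xi phi m B mphi)).
rewrite split_e disjoint_probU//; last 3 first.
- by apply: measurableI => //; exact: measurableC.
- exact: measurableI.
- by apply/seteqP; split=> // w [[_ ?] []].
rewrite !indep//; last exact: sigma_algebraC.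
rewrite !IHm probability_setC// Pphi -EFinB -!EFinM -EFinD bin_expectS.
by rewrite mulrC [X in _ + X]mulrC.
Qed.

(** Conditioning on the offspring of the root, which is almost surely 1 or [r]. *)
Lemma prob_root_children xi phi (p : R) r q A : measurable_functional phi ->
  mutually_independent xi ->
  (forall i, P [set w | phi (shift (fun u => xi u w) i)] = q%:E) ->
  (1 < r)%N -> P (xi [::] @^-1` [set 1%N]) = (1 - p)%:E ->
  P (xi [::] @^-1` [set r]) = p%:E ->
  P [set w | A (count_children phi (xi [::] w) xi w)] =
    ((1 - p) * bin_expect 1 q \1_A + p * bin_expect r q \1_A)%:E.
Proof.
move=> mphi xi_ind Pphi r1 P1 Pr; set E := [set w | _].
have gx a : <<s cylinders xi [set [::]] >> (xi [::] @^-1` [set a]).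
  by apply: sub_sigma_algebra; exact: cylinders_preimage.
have mx a : measurable (xi [::] @^-1` a) by exact: measurable_nat_preimage.
have mE : measurable E.
  apply: (@measurable_nat_preimage _ _
    (fun w => count_children phi (xi [::] w) xi w) A).
  apply: (@measurable_fun_comp_nat _ _ _ _ _
    (fun m w => count_children phi m xi w)) => // m _ B _; rewrite setTI.
  exact: g_cylinders_measurable (@g_count_children xi phi m B mphi).
(* On this event the random number of children becomes the constant [m], and the label [[::]] is not
   below any child. *)
have Em m : P (E `&` xi [::] @^-1` [set m]) =
    ((bin_expect m q \1_A)%:E * P (xi [::] @^-1` [set m]))%E.
  rewrite -(prob_count_children _ _ mphi xi_ind Pphi).
  have -> : E `&` xi [::] @^-1` [set m] =
      count_children phi m xi @^-1` A `&` xi [::] @^-1` [set m].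
    by apply/seteqP; split=> w [/= + wm]; rewrite /E/= wm.
  apply: (g_cylinders_indep xi_ind _ (@g_count_children xi phi m A mphi) (gx m)).
  by apply/seteqP; split=> // _ [[i [v [_ ->]]]].
(* [F] has probability [(1 - p) + p = 1], so its complement can be discarded. *)
pose F := xi [::] @^-1` [set 1%N] `|` xi [::] @^-1` [set r].
have r_neq1 : xi [::] @^-1` [set 1%N] `&` xi [::] @^-1` [set r] = set0.
  by apply/seteqP; split=> // w [/= -> r1']; rewrite r1' ltnn in r1.
have mF : measurable F by exact: measurableU.
have PF : P (~` F) = 0%E.
  rewrite probability_setC// [X in (_ - X)%E](_ : _ = 1%E) ?subee//.
  by rewrite disjoint_probU// P1 Pr -EFinD subrK.
have -> : E = (E `&` F) `|` (E `&` ~` F) by rewrite -setIUr setUv setIT.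
rewrite disjoint_probU//; last 3 first.
- exact: measurableI.
- by apply: measurableI => //; exact: measurableC.
- by rewrite setIACA setICr setI0.
rewrite [X in (_ + X)%E](_ : _ = 0%E) ?adde0; last first.
  apply/eqP; rewrite eq_le measure_ge0 andbT -PF.
  apply: le_measure; rewrite ?inE//; last exact: measurableC.
  by apply: measurableI => //; exact: measurableC.
rewrite setIUr disjoint_probU//; last 3 first.
- exact: measurableI.
- exact: measurableI.
- by rewrite setIACA r_neq1 setI0.
by rewrite !Em P1 Pr -!EFinM -EFinD mulrC [X in _ + X]mulrC.
Qed.

Lemma mutually_independent_shift xi i : mutually_independent xi ->
  mutually_independent (shift xi i).
Proof.
move=> xi_ind J A mA.
(* [behead] undoes the prefixing by [i], so label [i :: u] receives the set [A u]. *)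
have := xi_ind [fset i :: u | u in J]%fset (fun v => A (behead v)) (fun v => mA _).
rewrite big_imfset/=; last by move=> u v _ _ [].
move=> <-; congr (P _); apply/seteqP; split=> w H u /=.
  by case/imfsetP => v vJ ->; exact: H.
by move=> uJ; apply: (H (i :: u)); apply/imfsetP; exists u.
Qed.

Variables (p : R) (N r : nat).
Hypotheses (p_ge0 : 0 <= p) (p_le1 : p <= 1).
Hypotheses (N_gt1 : (1 < N)%N) (N_lt_r : (N < r)%N).

Local Notation BGW := (BGW_process (fun s : R => (1 - p) * s + p * s ^+ r)).

Lemma BGW_shift xi i : BGW xi -> BGW (shift xi i).
Proof.
by move=> [ind gf]; split=> [|u]; [exact: mutually_independent_shift|exact: gf].
Qed.

Lemma BGW_offspring xi u : BGW xi ->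
  P (xi u @^-1` [set 1%N]) = (1 - p)%:E /\ P (xi u @^-1` [set r]) = p%:E.
Proof.
move=> [_ /(_ u) gf].
have coef k : P (xi u @^-1` [set k]) =
    (((1 - p) *: 'X + p *: 'X^r) `_ k)%:E.
  apply: pgf_poly_coef => s s01; rewrite gf//.
  by rewrite hornerD !hornerZ hornerX hornerXn.
have r1 : (1 == r)%N = false by apply/negbTE; lia.
have r1' : (r == 1)%N = false by apply/negbTE; lia.
split; rewrite coef coefD !coefZ coefX coefXn ?eqxx ?r1 ?r1' ?mulr1 ?mulr0.
- by rewrite addr0.
- by rewrite add0r.
Qed.

Definition ge_N : set nat := [set k | (N <= k)%N].

(** A single child is fewer than [N], so this case drops out of the recursion. *)
Lemma bin_expect_ge_N1 q : bin_expect 1 q \1_ge_N = 0 :> R.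
Proof.
rewrite (eq_bin_expect _ (b := fun=> 0)) ?bin_expect_cst// => k k1.
by rewrite indicE memNset// /ge_N/=; lia.
Qed.

Fixpoint nary_upto_prob n : R :=
  if n is n'.+1 then p * bin_expect r (nary_upto_prob n') \1_ge_N else 1.

Lemma prob_nary_upto n xi : BGW xi ->
  P [set w | nary_upto N n (fun u => xi u w)] = (nary_upto_prob n)%:E.
Proof.
elim: n xi => [|n IHn] xi bgw /=.
  by rewrite [X in P X](_ : _ = setT) ?probability_setT//; apply/seteqP; split.
have [P1 Pr] := BGW_offspring [::] bgw; have [ind _] := bgw.
have mphi : measurable_functional (nary_upto N n).
  by move=> d' S X mX; exact: measurable_nary_upto.
have := prob_root_children ge_N mphi ind
  (fun i => IHn _ (BGW_shift i bgw)) (ltn_trans N_gt1 N_lt_r) P1 Pr.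
by rewrite bin_expect_ge_N1 mulr0 add0r.
Qed.

Lemma measurable_nary_functional : measurable_functional (fun x => `[< nary N x >]).
Proof. by move=> d' S X mX; exact: measurable_nary. Qed.

(** Continuity of [P] from above along the decreasing events of survival to depth [n]. *)
Lemma cvg_prob_nary xi : BGW xi ->
  (nary_upto_prob n)%:E @[n --> \oo] --> P [set w | nary N (fun u => xi u w)].
Proof.
move=> bgw.
have mn n : measurable [set w | nary_upto N n (fun u => xi u w)].
  rewrite -[X in measurable X]setTI.
  by apply: (@measurable_nary_upto _ _ N n xi _ measurableT [set true]).
under eq_fun => n do rewrite -(prob_nary_upto n bgw).
have -> : [set w | nary N (fun u => xi u w)] =
    \bigcap_n [set w | nary_upto N n (fun u => xi u w)].
  by apply/seteqP; split=> w H n; [move=> _; exact: H|exact: H].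
apply: nonincreasing_cvg_mu => //.
- by rewrite ltey_eq fin_num_measure.
- exact: bigcapT_measurable.
- by move=> m n mn'; apply/subsetPset => w; exact: nary_upto_le.
Qed.

Variable tau : R.
Hypothesis tau_largest : largest_in01
  (fun s : R => s = p * \sum_(N <= k < r.+1)
     'C(r, k)%:R * s ^+ k * (1 - s) ^+ (r - k)) tau.

Lemma tail_bin_expect s : \sum_(N <= k < r.+1)
     'C(r, k)%:R * s ^+ k * (1 - s) ^+ (r - k) = bin_expect r s \1_ge_N :> R.
Proof.
rewrite (big_nat_widenl _ 0%N)// big_mkcond big_mkord; apply: eq_bigr => k _.
rewrite indicE /=; case: ifPn => Nk; first by rewrite mem_set// mulr1.
by rewrite memNset ?mulr0//; exact/negP.
Qed.

Lemma nary_upto_prob_ge_tau n : tau <= nary_upto_prob n <= 1.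
Proof.
have [/andP[tau0 tau1] tauE _] := tau_largest.
have homo_ge : {homo (\1_ge_N : nat -> R) : k l / (k <= l)%N >-> k <= l}.
  move=> k l kl; rewrite !indicE ler_nat.
  have [Nk|Nk] := leqP N k; last by rewrite memNset//; apply/negP; rewrite -ltnNge.
  by rewrite [l \in _]mem_set ?leq_b1//; exact: leq_trans kl.
elim: n => [|n /andP[IH1 IH2]] /=; first by rewrite tau1 lexx.
apply/andP; split.
  rewrite {1}tauE tail_bin_expect ler_wpM2l//; exact: bin_expect_homo.
have q01 : 0 <= nary_upto_prob n <= 1 by rewrite IH2 (le_trans tau0).
apply: mulr_ile1 => //.
  rewrite -[X in X <= _](bin_expect_cst r (nary_upto_prob n)).
  exact: le_bin_expect.
rewrite -[X in _ <= X](bin_expect_cst r (nary_upto_prob n)).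
by apply: le_bin_expect => // k; rewrite indicE lern1 leq_b1.
Qed.

Lemma prob_nary xi : BGW xi ->
  P [set w | nary N (fun u => xi u w)] = tau%:E.
Proof.
move=> bgw; have lim := cvg_prob_nary bgw.
have [P1 Pr] := BGW_offspring [::] bgw; have [ind _] := bgw.
have mn : measurable [set w | nary N (fun u => xi u w)].
  have := @measurable_nary_functional _ _ xi.
  move=> /(_ (fun u => measurable_funPT _) measurableT [set true] I).
  rewrite setTI; congr measurable; apply/seteqP; split=> w /= /asboolP//.
have := fin_num_measure P _ mn.
have : (P [set w | nary N (fun u => xi u w)] <= 1)%E.
  exact: probability_le1.
have : (0 <= P [set w | nary N (fun u => xi u w)])%E by exact: measure_ge0.
move Eq : (P _) => Q; move: Eq; case: Q => [q Eq q0 q1 _|//|//].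
(* The tree of each child is again such a process, so its probability is the limit of the same
   sequence. *)
have child i : P [set w | `[< nary N (shift (fun u => xi u w) i) >]] = q%:E.
  rewrite -Eq; apply: (cvg_unique _ _ lim) => //.
  rewrite [X in P X](_ : _ = [set w | nary N (fun u => shift xi i u w)]).
    exact: cvg_prob_nary (BGW_shift i bgw).
  by apply/seteqP; split=> w /= /asboolP.
have qE : q = p * bin_expect r q \1_ge_N.
  apply: EFin_inj; rewrite -[LHS]Eq.
  (* The inserted zero is the contribution of a root with a single child. *)
  rewrite -[X in _ = X%:E]add0r -(mulr0 (1 - p)) -[X in _ * X](bin_expect_ge_N1 q).
  rewrite -(prob_root_children ge_N measurable_nary_functional ind child
    (ltn_trans N_gt1 N_lt_r) P1 Pr).
  by congr (P _); apply/seteqP; split=> w /= /naryP.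
congr EFin; apply/eqP; rewrite eq_le; have [_ _ tau_max] := tau_largest.
rewrite tau_max ?tail_bin_expect//=; last by move: q0 q1; rewrite !lee_fin => -> ->.
rewrite -lee_fin -Eq; apply: cvge_ge lim; apply: nearW => n.
by rewrite lee_fin; have /andP[] := nary_upto_prob_ge_tau n.
Qed.

(** [V_] is the number of N-ary children divided by [N], to which [prob_root_children] applies; a
    single child gives quotient 0. *)
Lemma prob_V xi A : BGW xi ->
  P (V_ N xi @^-1` A) =
    ((1 - p) * \1_A 0%N + p * bin_expect r tau (\1_A \o divn^~ N))%:E.
Proof.
move=> bgw; have [P1 Pr] := BGW_offspring [::] bgw; have [ind _] := bgw.
have N0 : (0 < N)%N by exact: ltnW.
have child i : P [set w | `[< nary N (shift (fun u => xi u w) i) >]] = tau%:E.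
  rewrite -(prob_nary (BGW_shift i bgw)).
  by congr (P _); apply/seteqP; split=> w /= /asboolP.
have := prob_root_children (divn^~ N @^-1` A) measurable_nary_functional ind child
  (ltn_trans N_gt1 N_lt_r) P1 Pr.
rewrite [X in P X = _](_ : _ = V_ N xi @^-1` A); last first.
  by apply/seteqP; split=> w; rewrite /V_ /= num_disjoint_NaryE.
move=> ->; congr (_ * _ + _)%:E.
rewrite (@eq_bin_expect _ _ _ _ (fun=> \1_A 0%N)) ?bin_expect_cst// => k k1.
rewrite -[LHS]/(\1_A (k %/ N)%N) divn_small//; exact: leq_ltn_trans N_gt1.
Qed.

Lemma measurable_V xi : measurable_fun setT (V_ N xi).
Proof.
rewrite (_ : V_ N xi = divn^~ N \o
    (fun w => count_children (fun x => `[< nary N x >]) (xi [::] w) xi w)).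
  apply: measurableT_comp => //.
  apply: (@measurable_fun_comp_nat _ _ _ _ _
    (fun m w => count_children (fun x => `[< nary N x >]) m xi w)) => // m _ B _.
  rewrite setTI.
  exact: g_cylinders_measurable
    (@g_count_children xi _ m B measurable_nary_functional).
by apply/funext => w; rewrite /V_ num_disjoint_NaryE// ltnW.
Qed.

End BGW.

(** * The law and the mean of [V_] *)

Theorem proposition3 (R : realType) (N r : nat) (p : R)
  (N_gt1 : (1 < N)%N) (N_lt_r : (N < r)%N) (p_gt0 : 0 < p) (p_lt1 : p < 1)
  (d : measure_display) (T : measurableType d) (P : probability T R)
  (xi : seq nat -> {RV P >-> nat})
  (xi_BGW : BGW_process (fun s : R => (1 - p) * s + p * s ^+ r) xi)
  (tau : R)
  (tau_largest : largest_in01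
     (fun s : R => s = p * \sum_(N <= k < r.+1)
                             'C(r, k)%:R * s ^+ k * (1 - s) ^+ (r - k)) tau)
  (d' : measure_display) (T' : measurableType d') (Q : probability T' R)
  (B : {RV Q >-> nat}) (B_bin : binomial_RV r tau B) :
  [/\ measurable_fun [set: T] (V_ N xi),
      P [set w | V_ N xi w = 0%N] =
        ((1 - p)%:E + p%:E * Q [set w | (B w <= N - 1)%N])%E,
      (forall j : nat, (0 < j)%N -> (j * N <= r)%N ->
        P [set w | V_ N xi w = j] =
          (p%:E * Q [set w | (j * N <= B w <= j * N + U_ N r j)%N])%E),
      (forall j : nat, (0 < j)%N -> (r < j * N)%N ->
        P [set w | V_ N xi w = j] = 0%E) &
      ('E_P[fun w => (V_ N xi w)%:R] =
        p%:E * \sum_(1 <= j < (r %/ N).+1)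
           (j%:R%:E * Q [set w | (j * N <= B w <= j * N + U_ N r j)%N]))%E].
Proof.
have [tau01 _ _] := tau_largest.
have p0 := ltW p_gt0; have p1 := ltW p_lt1; have N0 : (0 < N)%N by exact: ltnW.
have QB A : Q (B @^-1` A) = (bin_expect r tau \1_A)%:E.
  by rewrite -binomial_probE_expect// -B_bin.
have PV A : P (V_ N xi @^-1` A) =
    ((1 - p) * \1_A 0%N + p * bin_expect r tau (\1_A \o divn^~ N))%:E.
  exact: prob_V.
(* If [r < j * N], truncated subtraction makes [U_ N r j] zero and no [k <= r] satisfies either
   condition; [PV_big] draws on this case. *)
have PV_pos j : (0 < j)%N -> P [set w | V_ N xi w = j] =
    (p%:E * Q [set w | (j * N <= B w <= j * N + U_ N r j)%N])%E.
  move=> j0; rewrite (PV [set j]) (QB [set k | (j * N <= k <= j * N + U_ N r j)%N]).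
  rewrite [X in _ * X]indicE memNset ?mulr0 ?add0r ?EFinM; last first.
    by move=> /= j0'; rewrite -j0' in j0.
  (* [k %/ N = j] means that [k] lies between [j * N] and [j * N + (N - 1)]; the cap [r - j * N]
     removes nothing since [k <= r]. *)
  congr (_ * _%:E)%E; apply: eq_bin_expect => k kr.
  rewrite /= !indicE; congr (_ %:R); congr nat_of_bool.
  apply/idP/idP; rewrite !inE/=.
    by move=> kj; rewrite /U_ -kj; have := divn_eq k N; have := ltn_pmod k N0; lia.
  move=> /andP[k1 k2]; apply/eqP; rewrite eqn_leq leq_divRL// k1 andbT -ltnS.
  by rewrite ltn_divLR//; move: k2; rewrite /U_; lia.
have PV_big j : (0 < j)%N -> (r < j * N)%N -> P [set w | V_ N xi w = j] = 0%E.
  move=> j0 jr; rewrite PV_pos// (QB [set k | (j * N <= k <= j * N + U_ N r j)%N]).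
  rewrite (@eq_bin_expect _ _ _ _ (fun=> 0)) ?bin_expect_cst ?mule0// => k kr.
  by rewrite indicE memNset//=; lia.
have mV : measurable_fun [set: T] (V_ N xi) by exact: measurable_V.
split=> // [|j j0 _|].
- rewrite (PV [set 0%N]) (QB [set k | (k <= N - 1)%N]) indicE mem_set// mulr1.
  rewrite EFinD EFinM; congr (_ + _ * _%:E)%E; apply: eq_bin_expect => k _.
  rewrite /= !indicE; congr (_ %:R); congr nat_of_bool.
  apply/idP/idP; rewrite !inE/= => kN; last by rewrite divn_small//; lia.
  by have := divn_eq k N; have := ltn_pmod k N0; lia.
- exact: PV_pos.
(* At most [r] N-ary children occur almost surely, so [V_] exceeds [r %/ N] with probability
   zero. *)
rewrite (expectation_nat (M := (r %/ N)%N) mV).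
  rewrite ge0_sume_distrr; last by move=> j _; rewrite mule_ge0.
  by apply: eq_big_nat => j /andP[j0 _]; rewrite PV_pos// muleCA.
rewrite (PV [set k | (r %/ N < k)%N]) indicE memNset// mulr0 add0r.
rewrite (@eq_bin_expect _ _ _ _ (fun=> 0)) ?bin_expect_cst ?mulr0// => k kr.
by rewrite /= indicE memNset//=; apply/negP; rewrite -leqNgt; exact: leq_div2r.
Qed.
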